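(* (The Inversion Formula) Let $K$ be a field of characteristic zero, $A_n$ the $n$-th Weyl algebra over $K$, $P_m$ a polynomial algebra in $m$ variables over $K$, and $s=2n+m$. For each $\sigma\in\mathrm{Aut}_K(A_n\otimes P_m)$ and each $a\in A_n\otimes P_m$, $$\sigma^{-1}(a)=\sum_{\alpha\in\mathbb{N}^s}\phi_\sigma\!\left(\frac{(\partial')^\alpha}{\alpha!}\,a\right)x^\alpha,$$ where $(\partial')^\alpha:=(\partial_1')^{\alpha_1}\cdots(\partial_s')^{\alpha_s}$, $\alpha!:=\alpha_1!\cdots\alpha_s!$, and the derivations $\partial_i'$ and the map $\phi_\sigma$ attached to $\sigma$ are given by the explicit formulas in the context.
   Context: $A_n$ is generated over $K$ by $q_1,\dots,q_n,p_1,\dots,p_n$ subject to $[p_i,q_j]=\delta_{ij}$, $[p_i,p_j]=[q_i,q_j]=0$, where $[a,b]=ab-ba$; $P_m=K[x_{2n+1},\dots,x_{2n+m}]$; $\otimes=\otimes_K$. Put $x_i:=q_i$, $x_{n+i}:=p_i$ for $1\le i\le n$. The ordered monomials $x^\alpha=x_1^{\alpha_1}\cdots x_s^{\alpha_s}$, $\alpha\in\mathbb{N}^s$, form a $K$-basis of $A_n\otimes P_m$. The centre of $A_n\otimes P_m$ is $P_m$, so $\sigma$ restricts to an automorphism of $P_m$ and $$\Delta:=\det\left(\frac{\partial\sigma(x_{2n+i})}{\partial x_{2n+j}}\right)_{1\le i,j\le m}\in K^*=K\setminus\{0\}.$$ Put $x_i':=\sigma(x_i)$ for $i=1,\dots,s$.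 The corresponding ''partial derivatives'' $\partial_1'=\frac{\partial}{\partial x_1'},\dots,\partial_s'=\frac{\partial}{\partial x_s'}$ (a set of commuting locally nilpotent derivations of $A_n\otimes P_m$) are given by $$\partial_i':=\mathrm{ad}(\sigma(x_{n+i})),\qquad \partial_{n+i}':=-\mathrm{ad}(\sigma(x_i)),\qquad i=1,\dots,n,$$ where $\mathrm{ad}(a)(b)=[a,b]$, and, for $j=1,\dots,m$, $$\partial_{2n+j}':=\Delta^{-1}\det\begin{pmatrix}\frac{\partial\sigma(x_{2n+1})}{\partial x_{2n+1}}&\cdots&\frac{\partial\sigma(x_{2n+1})}{\partial x_{2n+m}}\\ \vdots&\vdots&\vdots\\ \frac{\partial}{\partial x_{2n+1}}&\cdots&\frac{\partial}{\partial x_{2n+m}}\\ \vdots&\vdots&\vdots\\ \frac{\partial\sigma(x_{2n+m})}{\partial x_{2n+1}}&\cdots&\frac{\partial\sigma(x_{2n+m})}{\partial x_{2n+m}}\end{pmatrix},$$ i.e. in the Jacobian matrix $\left(\frac{\partial\sigma(x_{2n+k})}{\partial x_{2n+l}}\right)_{1\le k,l\le m}$ the $j$-th row (that of $\sigma(x_{2n+j})$) is replaced by the row $\left(\frac{\partial}{\partial x_{2n+1}},\dots,\frac{\partial}{\partial x_{2n+m}}\right)$ of partial derivatives of $A_n\otimes P_m$ with respect to the canonical generators $x_{2n+1},\dots,x_{2n+m}$. For each $i=1,\dots,s$ define $$\phi_i':=\sum_{k\ge0}(-1)^k\frac{(x_i')^k}{k!}(\partial_i')^k:\ A_n\otimes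 P_m\to A_n\otimes P_m$$ (apply $(\partial_i')^k$, then multiply on the left by $(-1)^k(x_i')^k/k!$), and put $\phi_\sigma:=\phi_s'\phi_{s-1}'\cdots\phi_1'$; the order is important, $\phi_1'$ being applied first.
   Formalization: The operators ∂/∂x_{2n+l} in the replaced determinant row are taken as the derivations vanishing on σ(x_1),…,σ(x_{2n}) (not on x_1,…,x_{2n}) with ∂x_{2n+k}/∂x_{2n+l}=δ_{kl}; with the canonical ones the formula fails, e.g. n=m=1, q↦q+x_3, p↦p, x_3↦x_3. *)

(* Defs.v *)
From HB Require Import structures.
From mathcomp Require Import all_boot all_order all_algebra.
From mathcomp Require Import boolp classical_sets cardinality fsbigop.
From mathcomp Require Import -(notations) mpoly.

Set Implicit Arguments.
Unset Strict Implicit.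
Unset Printing Implicit Defensive.

Import GRing.Theory.
Local Open Scope ring_scope.
Local Open Scope quotient_scope.

(* The algebra A_n (x) P_m is defined by its presentation: the K-algebra on
   generators x_0, ..., x_(2n+m-1), where q_1, ..., q_n come first, then
   p_1, ..., p_n, then the m central variables.  Its elements are formal
   noncommutative polynomial expressions, identified by the least congruence
   containing the axioms of K-algebras and the defining relations. *)

Definition iq (n m : nat) (i : 'I_n) : 'I_(n + n + m) := lshift m (lshift n i).
Definition ip (n m : nat) (i : 'I_n) : 'I_(n + n + m) := lshift m (rshift n i).
Definition iz (n m : nat) (j : 'I_m) : 'I_(n + n + m) := rshift (n + n) j.
Arguments iq {n m} i.
Arguments ip {n m} i.
Arguments iz {n m} j.

Inductive term (K : Type) (s : nat) : Type :=
| Gen of 'I_s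
| Cst of K
| Add of term K s & term K s
| Opp of term K s
| Mul of term K s & term K s.
Arguments Gen {K s} i.
Arguments Cst {K s} c.

HB.instance Definition _ (K : Type) (s : nat) := gen_eqMixin (term K s).
HB.instance Definition _ (K : Type) (s : nat) := gen_choiceMixin (term K s).

Inductive weyl_eq (K : fieldType) (n m : nat) :
  term K (n + n + m) -> term K (n + n + m) -> Prop :=
| WRefl t : weyl_eq t t
| WSym t u : weyl_eq t u -> weyl_eq u t
| WTrans t u v : weyl_eq t u -> weyl_eq u v -> weyl_eq t v
| WAdd t t' u u' : weyl_eq t t' -> weyl_eq u u' ->
    weyl_eq (Add t u) (Add t' u')
| WOpp t t' : weyl_eq t t' -> weyl_eq (Opp t) (Opp t')
| WMul t t' u u' : weyl_eq t t' -> weyl_eq u u' ->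
    weyl_eq (Mul t u) (Mul t' u')
| WAddA t u v : weyl_eq (Add t (Add u v)) (Add (Add t u) v)
| WAddC t u : weyl_eq (Add t u) (Add u t)
| WAdd0 t : weyl_eq (Add (Cst 0) t) t
| WAddN t : weyl_eq (Add (Opp t) t) (Cst 0)
| WMulA t u v : weyl_eq (Mul t (Mul u v)) (Mul (Mul t u) v)
| WMul1l t : weyl_eq (Mul (Cst 1) t) t
| WMul1r t : weyl_eq (Mul t (Cst 1)) t
| WMulDl t u v : weyl_eq (Mul (Add t u) v) (Add (Mul t v) (Mul u v))
| WMulDr t u v : weyl_eq (Mul t (Add u v)) (Add (Mul t u) (Mul t v))
| WCstD c d : weyl_eq (Cst (c + d)) (Add (Cst c) (Cst d))
| WCstM c d : weyl_eq (Cst (c * d)) (Mul (Cst c) (Cst d))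
| WCstC c t : weyl_eq (Mul (Cst c) t) (Mul t (Cst c))
| WRel_pq (i j : 'I_n) :
    weyl_eq (Mul (Gen (ip i)) (Gen (iq j)))
            (Add (Mul (Gen (iq j)) (Gen (ip i))) (Cst (i == j)%:R))
| WRel_qq (i j : 'I_n) :
    weyl_eq (Mul (Gen (iq i)) (Gen (iq j))) (Mul (Gen (iq j)) (Gen (iq i)))
| WRel_pp (i j : 'I_n) :
    weyl_eq (Mul (Gen (ip i)) (Gen (ip j))) (Mul (Gen (ip j)) (Gen (ip i)))
| WRel_z (j : 'I_m) (k : 'I_(n + n + m)) :
    weyl_eq (Mul (Gen (iz j)) (Gen k)) (Mul (Gen k) (Gen (iz j))).

Section WeylPoly.
Variables (K : fieldType) (n m : nat).
Local Notation s := (n + n + m)%N.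
Local Notation T := (term K s).

Definition weyl_eqb (t u : T) : bool := `[< weyl_eq t u >].

Lemma weyl_eqb_equiv : equiv_class_of weyl_eqb.
Proof.
split=> [t|t u|u t v].
- by apply/asboolP; exact: WRefl.
- by apply/idP/idP=> /asboolP h; apply/asboolP; exact: WSym.
- by move=> /asboolP h /asboolP h'; apply/asboolP; exact: WTrans h h'.
Qed.

Canonical weyl_eqb_rel := EquivRelPack weyl_eqb_equiv.

Definition weyl_poly : Type := {eq_quot weyl_eqb}.

HB.instance Definition _ := Choice.on weyl_poly.
HB.instance Definition _ := EqQuotient.on weyl_poly.

Definition wpi (t : T) : weyl_poly := \pi_weyl_poly t.

Lemma wpi_eq (t u : T) : weyl_eq t u <-> wpi t = wpi u.
Proof.
split=> [h|/eqmodP/asboolP//].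
by apply/eqmodP/asboolP.
Qed.

Lemma wpi_repr (a : weyl_poly) : wpi (repr a) = a.
Proof. exact: reprK. Qed.

Definition wadd (a b : weyl_poly) := wpi (Add (repr a) (repr b)).
Definition wopp (a : weyl_poly) := wpi (Opp (repr a)).
Definition wmul (a b : weyl_poly) := wpi (Mul (repr a) (repr b)).
Definition wscale (c : K) (a : weyl_poly) := wpi (Mul (Cst c) (repr a)).

Lemma repr_wpi (t : T) : weyl_eq (repr (wpi t)) t.
Proof. by apply/wpi_eq; rewrite wpi_repr. Qed.

Lemma waddE t u : wadd (wpi t) (wpi u) = wpi (Add t u).
Proof. by apply/wpi_eq; apply: WAdd; exact: repr_wpi. Qed.
Lemma woppE t : wopp (wpi t) = wpi (Opp t).
Proof. by apply/wpi_eq; apply: WOpp; exact: repr_wpi. Qed.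
Lemma wmulE t u : wmul (wpi t) (wpi u) = wpi (Mul t u).
Proof. by apply/wpi_eq; apply: WMul; exact: repr_wpi. Qed.
Lemma wscaleE c t : wscale c (wpi t) = wpi (Mul (Cst c) t).
Proof.
by apply/wpi_eq; apply: WMul; [exact: WRefl|exact: repr_wpi].
Qed.

Definition wE := (waddE, woppE, wmulE, wscaleE).

Lemma wpiP (P : weyl_poly -> Prop) : (forall t, P (wpi t)) -> forall a, P a.
Proof. by move=> h a; rewrite -(wpi_repr a); exact: h. Qed.

Lemma waddA : associative wadd.
Proof.
elim/wpiP=> t; elim/wpiP=> u; elim/wpiP=> v.
by rewrite !wE; apply/wpi_eq; exact: WAddA.
Qed.
Lemma waddC : commutative wadd.
Proof.
elim/wpiP=> t; elim/wpiP=> u.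
by rewrite !wE; apply/wpi_eq; exact: WAddC.
Qed.
Lemma wadd0 : left_id (wpi (Cst 0)) wadd.
Proof. by elim/wpiP=> t; rewrite !wE; apply/wpi_eq; exact: WAdd0. Qed.
Lemma waddN : left_inverse (wpi (Cst 0)) wopp wadd.
Proof. by elim/wpiP=> t; rewrite !wE; apply/wpi_eq; exact: WAddN. Qed.

HB.instance Definition _ :=
  GRing.isZmodule.Build weyl_poly waddA waddC wadd0 waddN.

Lemma wmulA : associative wmul.
Proof.
elim/wpiP=> t; elim/wpiP=> u; elim/wpiP=> v.
by rewrite !wE; apply/wpi_eq; exact: WMulA.
Qed.
Lemma wmul1l : left_id (wpi (Cst 1)) wmul.
Proof. by elim/wpiP=> t; rewrite !wE; apply/wpi_eq; exact: WMul1l. Qed.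
Lemma wmul1r : right_id (wpi (Cst 1)) wmul.
Proof. by elim/wpiP=> t; rewrite !wE; apply/wpi_eq; exact: WMul1r. Qed.
Lemma wmulDl : left_distributive wmul wadd.
Proof.
elim/wpiP=> t; elim/wpiP=> u; elim/wpiP=> v.
by rewrite !wE; apply/wpi_eq; exact: WMulDl.
Qed.
Lemma wmulDr : right_distributive wmul wadd.
Proof.
elim/wpiP=> t; elim/wpiP=> u; elim/wpiP=> v.
by rewrite !wE; apply/wpi_eq; exact: WMulDr.
Qed.

(* 1 <> 0, seen by letting q_i and p_i act on K[X_1, ..., X_n] as X_i and
   d/dX_i, and the central variables as 0. *)
Local Notation V := (mpoly n K).

Fixpoint wact (t : T) (f : V) : V :=
  match t with
  | Gen k => match fintype.split k with
             | inl k' => match fintype.split k' with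
                         | inl i => mpolyX K (mnm1 i) * f
                         | inr i => mderiv i f
                         end
             | inr _ => 0
             end
  | Cst c => c *: f
  | Add t u => wact t f + wact u f
  | Opp t => - wact t f
  | Mul t u => wact t (wact u f)
  end.

Lemma wact_linear t : linear (wact t).
Proof.
elim: t => [k|c|t ht u hu|t ht|t ht u hu] a f g /=.
- case: fintype.split => [k'|_]; last by rewrite scaler0 addr0.
  case: fintype.split => i; last by rewrite linearP.
  by rewrite mulrDr scalerAr.
- by rewrite scalerDr !scalerA mulrC.
- by rewrite ht hu scalerDr addrACA.
- by rewrite ht opprD scalerN.
- by rewrite hu ht.
Qed.

Lemma wact_gen_q (i : 'I_n) f :
  wact (Gen (iq i)) f = mpolyX K (mnm1 i) * f.
Proof.
by rewrite /= /iq (unsplitK (inl _ : 'I_(n + n) + 'I_m)%type)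
  (unsplitK (inl _ : 'I_n + 'I_n)%type).
Qed.

Lemma wact_gen_p (i : 'I_n) f : wact (Gen (ip i)) f = mderiv i f.
Proof.
by rewrite /= /ip (unsplitK (inl _ : 'I_(n + n) + 'I_m)%type)
  (unsplitK (inr _ : 'I_n + 'I_n)%type).
Qed.

Lemma wact_gen_z (j : 'I_m) f : wact (Gen (iz j)) f = 0.
Proof. by rewrite /= /iz (unsplitK (inr _ : 'I_(n + n) + 'I_m)%type). Qed.

Lemma wact_eq t u : weyl_eq t u -> wact t =1 wact u.
Proof.
elim=> {t u}.
- by [].
- by move=> t u _ h f; rewrite h.
- by move=> t u v _ h _ h' f; rewrite h h'.
- by move=> t t' u u' _ h _ h' f /=; rewrite h h'.
- by move=> t t' _ h f /=; rewrite h.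
- by move=> t t' u u' _ h _ h' f /=; rewrite h h'.
- by move=> t u v f /=; rewrite addrA.
- by move=> t u f /=; rewrite addrC.
- by move=> t f /=; rewrite scale0r add0r.
- by move=> t f /=; rewrite addNr scale0r.
- by [].
- by move=> t f /=; rewrite scale1r.
- by move=> t f /=; rewrite scale1r.
- by [].
- move=> t u v f /=.
  by rewrite -{1}[wact u f]scale1r wact_linear scale1r.
- by move=> c d f /=; rewrite scalerDl.
- by move=> c d f /=; rewrite scalerA.
- move=> c t f /=.
  have t0 : wact t 0 = 0.
    by rewrite -{1}[0](subrr 0) -scaleN1r addrC wact_linear scaleN1r addNr.
  by have := wact_linear t c f 0; rewrite t0 !addr0 => ->.
- move=> i j f.
  rewrite -[LHS]/(wact (Gen (ip i)) (wact (Gen (iq j)) f)).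
  rewrite -[RHS]/(wact (Gen (iq j)) (wact (Gen (ip i)) f) + (i == j)%:R *: f).
  rewrite !wact_gen_p !wact_gen_q mderivM addrC; congr (_ + _).
  rewrite mderivX mnm1E eq_sym.
  case: eqP => [->|_]; last by rewrite !scale0r mul0r.
  have -> : mnm_sub (mnm1 j) (mnm1 j) = mnm0.
    by apply/mnmP=> k; rewrite mnmBE subnn mnm0E.
  by rewrite mpolyX0 !scale1r mul1r.
- move=> i j f.
  rewrite -[LHS]/(wact (Gen (iq i)) (wact (Gen (iq j)) f)).
  rewrite -[RHS]/(wact (Gen (iq j)) (wact (Gen (iq i)) f)).
  by rewrite !wact_gen_q mulrCA.
- move=> i j f.
  rewrite -[LHS]/(wact (Gen (ip i)) (wact (Gen (ip j)) f)).
  rewrite -[RHS]/(wact (Gen (ip j)) (wact (Gen (ip i)) f)).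
  by rewrite !wact_gen_p mderiv_comm.
- move=> j k f.
  rewrite -[LHS]/(wact (Gen (iz j)) (wact (Gen k) f)).
  rewrite -[RHS]/(wact (Gen k) (wact (Gen (iz j)) f)).
  rewrite !wact_gen_z.
  by rewrite -[X in wact _ X](subrr (0 : V)) -scaleN1r addrC wact_linear
    scaleN1r addNr.
Qed.

Lemma w1_neq0 : wpi (Cst 1) != 0 :> weyl_poly.
Proof.
apply/eqP=> /wpi_eq/wact_eq/(_ 1) /=.
by rewrite scale1r scale0r; apply/eqP; exact: oner_neq0.
Qed.

HB.instance Definition _ :=
  GRing.Zmodule_isNzRing.Build weyl_poly
    wmulA wmul1l wmul1r wmulDl wmulDr w1_neq0.

Lemma wscaleA c d (a : weyl_poly) : wscale c (wscale d a) = wscale (c * d) a.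
Proof.
elim/wpiP: a => t; rewrite !wE; apply/wpi_eq.
by apply: WTrans (WMulA _ _ _) _; apply: WMul; [exact/WSym/WCstM|exact: WRefl].
Qed.
Lemma wscale1 : left_id 1 wscale.
Proof. by elim/wpiP=> t; rewrite !wE; apply/wpi_eq; exact: WMul1l. Qed.
Lemma wscaleDr : right_distributive wscale +%R.
Proof.
move=> c; elim/wpiP=> t; elim/wpiP=> u.
by rewrite -[_ + _]/(wadd _ _) -[RHS]/(wadd _ _) !wE; apply/wpi_eq; exact: WMulDr.
Qed.
Lemma wscaleDl a : {morph wscale^~ a : c d / c + d}.
Proof.
move=> c d; elim/wpiP: a => t; rewrite -[RHS]/(wadd _ _) !wE; apply/wpi_eq.
apply: WTrans (WMulDl _ _ _); apply: WMul; [exact: WCstD|exact: WRefl].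
Qed.

HB.instance Definition _ :=
  GRing.Zmodule_isLmodule.Build K weyl_poly wscaleA wscale1 wscaleDr wscaleDl.

Lemma wscaleAl (c : K) (a b : weyl_poly) : c *: (a * b) = c *: a * b.
Proof.
elim/wpiP: a => t; elim/wpiP: b => u.
rewrite -![_ * _]/(wmul _ _) -![_ *: _]/(wscale _ _) !wE.
by apply/wpi_eq; exact: WMulA.
Qed.

HB.instance Definition _ :=
  GRing.Lmodule_isLalgebra.Build K weyl_poly wscaleAl.

Lemma wscaleAr (c : K) (a b : weyl_poly) : c *: (a * b) = a * (c *: b).
Proof.
elim/wpiP: a => t; elim/wpiP: b => u.
rewrite -![_ * _]/(wmul _ _) -![_ *: _]/(wscale _ _) !wE; apply/wpi_eq.
apply: WTrans (WMulA _ _ _) _; apply: WTrans (WSym (WMulA _ _ _)).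
by apply: WMul; [exact: WCstC|exact: WRefl].
Qed.

HB.instance Definition _ :=
  GRing.Lalgebra_isAlgebra.Build K weyl_poly wscaleAr.

Definition wx (i : 'I_s) : weyl_poly := wpi (Gen i).

Definition ad (a b : weyl_poly) : weyl_poly := a * b - b * a.

Definition is_derivation (d : weyl_poly -> weyl_poly) : Prop :=
  linear d /\ forall a b, d (a * b) = d a * b + a * d b.

(* \prod and foldr/foldl over the ordinals follow increasing indices, so that
   monomials are ordered and compositions occur in the prescribed order. *)
Definition mon (alpha : {ffun 'I_s -> nat}) : weyl_poly :=
  \prod_(i < s) wx i ^+ alpha i.

Definition mfact (alpha : {ffun 'I_s -> nat}) : nat :=
  \prod_(i < s) (alpha i)`!.

Section Sigma.
Variable sigma : weyl_poly -> weyl_poly.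

(* d_l is the partial derivative d/dx_(2n+l) in the generating system
   sigma(x_1), ..., sigma(x_2n), x_(2n+1), ..., x_(2n+m).  A partial derivative
   depends on all the coordinates, and the formula for d/dx'_(2n+j) below needs
   d/dx_(2n+l) to be taken with sigma(q_i) and sigma(p_i) held fixed: holding
   q_i and p_i fixed instead, it is not d/dx'_(2n+j) when sigma(q_i) or
   sigma(p_i) involves a central variable, e.g. n = m = 1, q |-> q + x_3,
   p |-> p, x_3 |-> x_3.  Both choices agree on P_m. *)
Definition is_partials (d : 'I_m -> weyl_poly -> weyl_poly) : Prop :=
  forall l, [/\ is_derivation (d l),
    forall i : 'I_(n + n), d l (sigma (wx (lshift m i))) = 0 &
    forall k, d l (wx (iz k)) = (l == k)%:R].

Variable d : 'I_m -> weyl_poly -> weyl_poly.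

Definition jacobian : 'M[weyl_poly]_m :=
  \matrix_(k < m, l < m) d l (sigma (wx (iz k))).

(* The determinant of the jacobian is a scalar. *)
Definition Delta : K := xget 0 [set c | c%:A = \det jacobian]%classic.

(* Outside the j-th row the entries are central, hence the Leibniz formula for
   \det is not affected by the order of its factors. *)
Definition dprime (i : 'I_s) (a : weyl_poly) : weyl_poly :=
  match fintype.split i with
  | inl i' => match fintype.split i' with
              | inl k => ad (sigma (wx (ip k))) a
              | inr k => - ad (sigma (wx (iq k))) a
              end
  | inr j => Delta^-1 *:
      \det (\matrix_(k < m, l < m)
              if k == j then d l a else d l (sigma (wx (iz k))))
  end.

Definition dprime_pow (alpha : {ffun 'I_s -> nat}) (a : weyl_poly) :
  weyl_poly := foldr (fun i => iter (alpha i) (dprime i)) a (enum 'I_s).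

Definition locally_nilpotent (f : weyl_poly -> weyl_poly) : Prop :=
  forall a, exists N, forall k, (N <= k)%N -> iter k f a = 0.

(* Sums over infinite index sets are finitely supported sums, which have the
   junk value 0 when the support is infinite. *)
Definition phi1 (i : 'I_s) (a : weyl_poly) : weyl_poly :=
  \sum_(k \in [set: nat]%classic)
    ((-1) ^+ k / k`!%:R) *: (sigma (wx i) ^+ k * iter k (dprime i) a).

Definition phi (a : weyl_poly) : weyl_poly :=
  foldl (fun b i => phi1 i b) a (enum 'I_s).

Definition inv_term (a : weyl_poly) (alpha : {ffun 'I_s -> nat}) : weyl_poly :=
  phi ((mfact alpha)%:R^-1 *: dprime_pow alpha a) * mon alpha.

End Sigma.

End WeylPoly.

(* Main.v *)
Require Import Defs.
From HB Require Import structures.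
From mathcomp Require Import all_boot all_order all_algebra.
From mathcomp Require Import perm boolp classical_sets cardinality fsbigop.
From mathcomp Require Import -(notations) mpoly.

(** Let [W] be the algebra. Suppose first that [sigma] is the identity. Then the
    formula is Taylor's: with [d_i] the partial derivative in the canonical
    generator [x_i], the Dixmier map attached to [d_i] and [x_i] is linear,
    fixes the kernel of [d_i] and kills every left multiple of [x_i]
    ([dixmier_const], [dixmier_mulx]). Applied one after the other, from the
    leftmost generator to the rightmost one, these maps send the ordered
    monomial [x^g] to 1 if [g = 0] and to 0 otherwise ([dix_fold_mon]). As the
    derivatives of an ordered monomial are computed variable by variable, the
    composite [phi] satisfies [phi (d^al x^be / al!) = 1] if [al = be] and [0]
    otherwise ([taylor_coef_mon]). Ordered monomials span [W]
    ([monomials_span]), so [b] is the sum of the [phi (d^al b / al!) x^al] for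
    every [b] ([taylor]), and the coefficients are scalars
    ([dix_fold_scalar]).

    For general [sigma], with inverse [tau], the point is that the derivations
    [dprime sigma d i] are the conjugates [sigma d_i tau] ([dprimeE]). Granted
    this, the map [phi] attached to [sigma] is the conjugate of the one above,
    and the term of index [al] at [a] is [sigma] of a Taylor coefficient of
    [tau a], times [x^al]. As [sigma] fixes scalars, this is the Taylor term of
    [tau a] ([inv_termE]), and the sum is [tau a].

    A derivation is determined by its values on the generators [sigma x_j], so
    [dprimeE] amounts to saying that [dprime sigma d i] is a derivation dual to
    them. For the derivations attached to the central variables this rests on
    three facts. The centre of [W] is the polynomial algebra in the central
    variables ([zpoly_inj], [central_is_zpoly]), so the jacobian has
    commuting entries. The chain rule makes it invertible over polynomials, so
    its determinant is a nonzero scalar ([jacobian_unit], [Delta_spec]). And a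
    determinant with one row of derivations and the others central is a
    derivation ([det_row_der]), whose values on the [sigma x_j] are determinants
    with repeated or zero rows, except for one ([dprime_z_gen]). *)

Set Implicit Arguments.
Unset Strict Implicit.
Unset Printing Implicit Defensive.

Import GRing.Theory.
Local Open Scope ring_scope.

(** * The algebra and its generators *)

Section Presentation.
Variables (K : fieldType) (n m : nat).
Local Notation s := (n + n + m)%N.
Local Notation W := (weyl_poly K n m).
Local Notation wx := (@wx K n m).
Implicit Types (a b : W) (c : K).

Variant index_spec : 'I_s -> Type :=
| IndexQ k : index_spec (iq k)
| IndexP k : index_spec (ip k)
| IndexZ j : index_spec (iz j).

Lemma indexP i : index_spec i.
Proof.
rewrite -[i]splitK; case: (fintype.split i) => [i'|j] /=; last exact: IndexZ.
by rewrite -[i']splitK; case: (fintype.split i') => k /=;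
  [exact: IndexQ|exact: IndexP].
Qed.

Lemma split_iq k : fintype.split (iq k : 'I_s) = inl (lshift n k).
Proof. exact: (unsplitK (inl _)). Qed.

Lemma split_ip k : fintype.split (ip k : 'I_s) = inl (rshift n k).
Proof. exact: (unsplitK (inl _)). Qed.

Lemma split_iz (j : 'I_m) : fintype.split (iz j : 'I_s) = inr j.
Proof. exact: (unsplitK (inr _)). Qed.

Lemma split_lshift (k : 'I_n) : fintype.split (lshift n k) = inl k.
Proof. exact: (unsplitK (inl _)). Qed.

Lemma split_rshift (k : 'I_n) : fintype.split (rshift n k) = inr k.
Proof. exact: (unsplitK (inr _)). Qed.

Definition split_indexE := (split_iq, split_ip, split_iz, split_lshift,
  split_rshift).

Lemma eq_index_qq k l : ((iq k : 'I_s) == iq l) = (k == l).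
Proof. by rewrite /iq !(inj_eq (@lshift_inj _ _)). Qed.
Lemma eq_index_pp k l : ((ip k : 'I_s) == ip l) = (k == l).
Proof.
by rewrite /ip (inj_eq (@lshift_inj _ _)) (inj_eq (@rshift_inj _ _)).
Qed.
Lemma eq_index_zz (k l : 'I_m) : ((iz k : 'I_s) == iz l) = (k == l).
Proof. by rewrite /iz (inj_eq (@rshift_inj _ _)). Qed.
Lemma eq_index_qp k l : ((iq k : 'I_s) == ip l) = false.
Proof. by rewrite /iq /ip (inj_eq (@lshift_inj _ _)) eq_lrshift. Qed.
Lemma eq_index_pq k l : ((ip k : 'I_s) == iq l) = false.
Proof. by rewrite eq_sym eq_index_qp. Qed.
Lemma eq_index_zl (j : 'I_m) (k : 'I_(n + n)) :
  ((iz j : 'I_s) == lshift m k) = false.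
Proof. by rewrite /iz eq_rlshift. Qed.
Lemma eq_index_lz (j : 'I_m) (k : 'I_(n + n)) :
  ((lshift m k : 'I_s) == iz j) = false.
Proof. by rewrite eq_sym eq_index_zl. Qed.

Definition eq_indexE := (eq_index_qq, eq_index_pp, eq_index_zz, eq_index_qp,
  eq_index_pq, eq_index_zl, eq_index_lz).

Lemma wpi_Cst c : @wpi K n m (Cst c) = c%:A.
Proof.
by rewrite -[RHS]/(wscale c (wpi _)) wscaleE; apply/wpi_eq/WSym/WMul1r.
Qed.

Lemma wpi_Add t u : @wpi K n m (Add t u) = @wpi K n m t + @wpi K n m u :> W.
Proof. by rewrite -[RHS]/(wadd _ _) waddE. Qed.

Lemma wpi_Opp t : @wpi K n m (Opp t) = - @wpi K n m t :> W.
Proof. by rewrite -[RHS]/(wopp _) woppE. Qed.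

Lemma wpi_Mul t u : @wpi K n m (Mul t u) = @wpi K n m t * @wpi K n m u :> W.
Proof. by rewrite -[RHS]/(wmul _ _) wmulE. Qed.

Definition wpiE := (wpi_Cst, wpi_Add, wpi_Opp, wpi_Mul).

Lemma weyl_ind (P : W -> Prop) :
    (forall c, P c%:A) -> (forall i, P (wx i)) ->
    (forall a b, P a -> P b -> P (a + b)) ->
    (forall a b, P a -> P b -> P (a * b)) ->
  forall a, P a.
Proof.
move=> PC Px PD PM; apply: wpiP; elim=> [i|c|t Pt u Pu|t Pt|t Pt u Pu].
- exact: Px.
- by rewrite wpi_Cst.
- by rewrite wpi_Add; apply: PD.
- by rewrite wpi_Opp -scaleN1r -mulr_algl; apply: PM.
- by rewrite wpi_Mul; apply: PM.
Qed.

Lemma wx_pq k l :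
  wx (ip k) * wx (iq l) = wx (iq l) * wx (ip k) + (k == l)%:R.
Proof.
have := WRel_pq K m k l; rewrite wpi_eq !wpiE => ->.
by rewrite scaler_nat.
Qed.

Lemma wx_qq k l : wx (iq k) * wx (iq l) = wx (iq l) * wx (iq k).
Proof. by have := WRel_qq K m k l; rewrite wpi_eq !wpiE. Qed.

Lemma wx_pp k l : wx (ip k) * wx (ip l) = wx (ip l) * wx (ip k).
Proof. by have := WRel_pp K m k l; rewrite wpi_eq !wpiE. Qed.

Definition central a : Prop := forall b, a * b = b * a.

Lemma central_alg c : central c%:A.
Proof. by move=> b; rewrite mulr_algl mulr_algr. Qed.

Lemma central1 : central 1.
Proof. by move=> b; rewrite mul1r mulr1. Qed.

Lemma centralD a b : central a -> central b -> central (a + b).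
Proof. by move=> ca cb y; rewrite mulrDl mulrDr ca cb. Qed.

Lemma centralM a b : central a -> central b -> central (a * b).
Proof. by move=> ca cb y; rewrite -mulrA cb mulrA ca mulrA. Qed.

Lemma centralX a k : central a -> central (a ^+ k).
Proof.
move=> ca; elim: k => [|k IHk]; first exact: central1.
by rewrite exprS; exact: centralM.
Qed.

Lemma central_prod (I : Type) (r : seq I) (P : pred I) (F : I -> W) :
  (forall i, P i -> central (F i)) -> central (\prod_(i <- r | P i) F i).
Proof.
by move=> cF; apply: big_ind => //; [exact: central1|exact: centralM].
Qed.

Lemma central_wxz (j : 'I_m) : central (wx (iz j)).
Proof.
elim/weyl_ind=> [c|i|a b ca cb|a b ca cb].
- by rewrite mulr_algl mulr_algr.
- by have := WRel_z K j i; rewrite wpi_eq !wpiE.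
- by rewrite mulrDl mulrDr ca cb.
- by rewrite mulrA ca -mulrA cb mulrA.
Qed.

End Presentation.

(** * Derivations *)

Section Derivation.
Variables (K : fieldType) (n m : nat).
Local Notation W := (weyl_poly K n m).
Implicit Types (D : W -> W) (a b : W).

Lemma der0 D (dD : is_derivation D) : D 0 = 0.
Proof.
by have [linD _] := dD; have := linD (-1) 0 0;
  rewrite scaler0 addr0 scaleN1r addNr.
Qed.

Lemma derD D (dD : is_derivation D) a b : D (a + b) = D a + D b.
Proof. by have [linD _] := dD; have := linD 1 a b; rewrite !scale1r. Qed.

Lemma derZ D (dD : is_derivation D) c a : D (c *: a) = c *: D a.
Proof. by have := dD.1 c a 0; rewrite (der0 dD) !addr0. Qed.

Lemma derM D (dD : is_derivation D) a b : D (a * b) = D a * b + a * D b.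
Proof. exact: dD.2. Qed.

Lemma der1 D (dD : is_derivation D) : D 1 = 0.
Proof.
have := derM dD 1 1; rewrite !mulr1 mul1r => /eqP.
by rewrite -subr_eq subrr eq_sym => /eqP.
Qed.

Lemma derC D (dD : is_derivation D) c : D c%:A = 0.
Proof. by rewrite (derZ dD) (der1 dD) scaler0. Qed.

Lemma iter_derZ D k c a : is_derivation D ->
  iter k D (c *: a) = c *: iter k D a.
Proof. by move=> dD; elim: k => //= k ->; rewrite (derZ dD). Qed.

Lemma iter_derD D k a b : is_derivation D ->
  iter k D (a + b) = iter k D a + iter k D b.
Proof. by move=> dD; elim: k => //= k ->; rewrite (derD dD). Qed.

Lemma iter_der_zero D k : is_derivation D -> iter k D 0 = 0.
Proof. by move=> dD; elim: k => //= k ->; rewrite (der0 dD). Qed.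

Lemma iter_der0 D k a : is_derivation D -> D a = 0 ->
  iter k D a = if k is 0 then a else 0.
Proof. by move=> dD Da; case: k => // k; rewrite iterSr Da iter_der_zero. Qed.

Lemma derX D x k : is_derivation D -> D x = 1 ->
  D (x ^+ k) = k%:R *: x ^+ k.-1.
Proof.
move=> dD Dx; elim: k => [|k IHk]; first by rewrite expr0 (der1 dD) scale0r.
rewrite exprS (derM dD) IHk Dx mul1r -scalerAr.
case: k {IHk} => [|k] /=; first by rewrite scale0r addr0 scale1r.
by rewrite -exprS -{1}[x ^+ k.+1]scale1r -scalerDl -mulrS.
Qed.

(** In the Leibniz rule only the factor of index [i] contributes. *)
Lemma der_prod_unique (I : eqType) (r : seq I) (F : I -> W) D i :
    is_derivation D -> (forall j, j != i -> D (F j) = 0) -> uniq r ->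
  D (\prod_(j <- r) F j) =
    if i \in r then \prod_(j <- r) (if j == i then D (F j) else F j) else 0.
Proof.
move=> dD D0; elim: r => [|j r IHr] /=; first by rewrite big_nil (der1 dD).
case/andP=> jNr Ur; rewrite !big_cons (derM dD) IHr // in_cons eq_sym.
have [eq_ji|ne_ji] := eqVneq j i; last first.
  by rewrite D0 // mul0r add0r; case: ifP; rewrite ?mulr0.
rewrite -eq_ji (negPf jNr) mulr0 addr0; congr (_ * _).
by apply: eq_big_seq => k kr; rewrite ifN //; apply: contraNneq jNr => <-.
Qed.

(** Differentiating [a * b = b * a] leaves [D a * b = b * D a], because the
    terms in [D b] already agree. *)
Lemma der_central D a : is_derivation D -> central a -> central (D a).
Proof.
move=> dD ca b; have := congr1 D (ca b).
by rewrite !(derM dD) (ca (D b)) addrC => /addrI.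
Qed.

Lemma der_centralZ D z : is_derivation D -> central z ->
  is_derivation (fun a => z * D a).
Proof.
move=> dD cz; split=> [c a b|a b].
  by rewrite (derD dD) (derZ dD) mulrDr scalerAr.
by rewrite (derM dD) mulrDr !mulrA cz -(mulrA a) cz mulrA.
Qed.

Lemma der_zero : is_derivation (fun _ : W => 0 : W).
Proof. by split=> [c a b|a b]; rewrite ?scaler0 ?mul0r ?mulr0 addr0. Qed.

Lemma der_add D D' : is_derivation D -> is_derivation D' ->
  is_derivation (fun a => D a + D' a).
Proof.
move=> dD dD'; split=> [c a b|a b].
  by rewrite (derD dD) (derD dD') (derZ dD) (derZ dD') scalerDr addrACA.
by rewrite (derM dD) (derM dD') mulrDl mulrDr addrACA.
Qed.

Lemma der_scale D c : is_derivation D -> is_derivation (fun a => c *: D a).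
Proof.
move=> dD; split=> [d a b|a b].
  by rewrite (derD dD) (derZ dD) scalerDr !scalerA mulrC.
by rewrite (derM dD) scalerDr scalerAl scalerAr.
Qed.

Lemma der_opp D : is_derivation D -> is_derivation (fun a => - D a).
Proof.
move=> dD; split=> [d a b|a b].
  by rewrite (derD dD) (derZ dD) opprD scalerN.
by rewrite (derM dD) opprD mulNr mulrN.
Qed.

Lemma der_sum (I : Type) (r : seq I) (P : pred I) (F : I -> W -> W) :
    (forall i, P i -> is_derivation (F i)) ->
  is_derivation (fun a => \sum_(i <- r | P i) F i a).
Proof.
move=> dF; elim: r => [|i r IHr].
  by under eq_fun => a do rewrite big_nil; exact: der_zero.
under eq_fun => a do rewrite big_cons.
by case: (P i) (dF i) => // dFi; apply: der_add; [exact: dFi|].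
Qed.

Lemma der_ad (x : W) : is_derivation (ad x).
Proof.
split=> [c a b|a b]; rewrite /ad.
  rewrite mulrDr mulrDl -scalerAr -scalerAl opprD addrACA.
  by rewrite scalerDr scalerN.
by rewrite mulrBl mulrBr !mulrA addrA subrK.
Qed.

Lemma der_conj (f g : {lrmorphism W -> W}) D : cancel g f ->
  is_derivation D -> is_derivation (fun a => f (D (g a))).
Proof.
move=> gK dD; split=> [c a b|a b].
  by rewrite linearP (derD dD) (derZ dD) linearP.
by rewrite rmorphM (derM dD) rmorphD !rmorphM /= !gK.
Qed.

(** The elements on which two derivations agree form a subalgebra, so it is
    enough that this subalgebra contain the images of the generators. *)
Lemma der_ext (f : {lrmorphism W -> W}) D D' :
    is_derivation D -> is_derivation D' ->
    (forall i, D (f (wx K i)) = D' (f (wx K i))) ->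
  forall a, D (f a) = D' (f a).
Proof.
move=> dD dD' eqx; elim/weyl_ind=> [c|i|a b IHa IHb|a b IHa IHb] //.
- by rewrite rmorph_alg (derC dD) (derC dD').
- by rewrite rmorphD (derD dD) (derD dD') IHa IHb.
- by rewrite rmorphM (derM dD) (derM dD') IHa IHb.
Qed.

End Derivation.

(** * Partial derivatives in the canonical generators *)

Section StandardPartials.
Variables (K : fieldType) (n m : nat).
Local Notation s := (n + n + m)%N.
Local Notation W := (weyl_poly K n m).
Local Notation wx := (@wx K n m).
Implicit Types (a b : W).

(** The derivative in the [l]-th central variable, computed by the Leibniz rule
    on the expressions that represent elements of the algebra. *)
Fixpoint dz_term (l : 'I_m) (t : term K s) : W :=
  match t with
  | Gen i => (i == iz l)%:R
  | Cst _ => 0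
  | Add t u => dz_term l t + dz_term l u
  | Opp t => - dz_term l t
  | Mul t u => dz_term l t * wpi u + wpi t * dz_term l u
  end.

(** The Leibniz rule respects the defining relations: the generators in the
    Weyl relations have derivative 0, and in the relations that make the
    central variables central both derivatives are integers. *)
Lemma dz_term_eq l t u : weyl_eq t u -> dz_term l t = dz_term l u.
Proof.
have cst c a : wpi (Cst c) * a = a * wpi (Cst c) :> W.
  by rewrite wpi_Cst; exact: central_alg.
elim=> {t u} /=.
- by [].
- by [].
- by move=> t u v _ -> _ ->.
- by move=> t t' u u' _ -> _ ->.
- by move=> t t' _ ->.
- by move=> t t' u u' /wpi_eq -> -> /wpi_eq -> ->.
- by move=> t u v; rewrite addrA.
- by move=> t u; rewrite addrC.
- by move=> t; rewrite add0r.
- by move=> t; rewrite addNr.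
- by move=> t u v; rewrite !wpiE mulrDr mulrDl !mulrA addrA.
- by move=> t; rewrite mul0r add0r wpi_Cst scale1r mul1r.
- by move=> t; rewrite mulr0 addr0 wpi_Cst scale1r mulr1.
- by move=> t u v; rewrite !wpiE !mulrDl addrACA.
- by move=> t u v; rewrite !wpiE !mulrDr addrACA.
- by move=> c d; rewrite addr0.
- by move=> c d; rewrite mul0r mulr0 addr0.
- by move=> c t; rewrite mul0r mulr0 add0r addr0 cst.
- by move=> i j; rewrite !eq_indexE !(mul0r, mulr0, addr0).
- by move=> i j; rewrite !eq_indexE !(mul0r, mulr0, addr0).
- by move=> i j; rewrite !eq_indexE !(mul0r, mulr0, addr0).
- move=> j k; rewrite addrC; congr (_ + _); first exact: central_wxz.
  exact/esym/commr_nat.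
Qed.

Definition dz (l : 'I_m) (a : W) : W := dz_term l (repr a).

Lemma dz_wpi l t : dz l (wpi t) = dz_term l t.
Proof. by apply: dz_term_eq; apply/wpi_eq; rewrite wpi_repr. Qed.

Lemma dz_der l : is_derivation (dz l).
Proof.
split=> [c a b|a b]; rewrite -[a]wpi_repr -[b]wpi_repr.
  rewrite -mulr_algl -wpi_Cst -wpi_Mul -wpi_Add !dz_wpi /= mul0r add0r.
  by rewrite wpi_Cst mulr_algl.
by rewrite -wpi_Mul !dz_wpi.
Qed.

Lemma dz_wx l i : dz l (wx i) = (i == iz l)%:R.
Proof. exact: dz_wpi. Qed.

(** The partial derivatives in the canonical generators, that is, the
    derivations that [dprime] ought to give when [sigma] is the identity. *)
Definition dx (i : 'I_s) (a : W) : W :=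
  match fintype.split i with
  | inl i' => match fintype.split i' with
              | inl k => ad (wx (ip k)) a
              | inr k => - ad (wx (iq k)) a
              end
  | inr l => dz l a
  end.

Lemma dx_q k a : dx (iq k) a = ad (wx (ip k)) a.
Proof. by rewrite /dx !split_indexE. Qed.
Lemma dx_p k a : dx (ip k) a = - ad (wx (iq k)) a.
Proof. by rewrite /dx !split_indexE. Qed.
Lemma dx_z l a : dx (iz l) a = dz l a.
Proof. by rewrite /dx !split_indexE. Qed.

Lemma dx_der i : is_derivation (dx i).
Proof.
case: (indexP i) => k.
- by rewrite /dx !split_indexE; exact: der_ad.
- by rewrite /dx !split_indexE; apply: der_opp; exact: der_ad.
- by rewrite /dx !split_indexE; exact: dz_der.
Qed.

Lemma dx_wx i j : dx i (wx j) = (i == j)%:R.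
Proof.
case: (indexP i) => k; case: (indexP j) => l;
  rewrite ?(dx_q, dx_p, dx_z) !eq_indexE.
- by rewrite /ad wx_pq addrC addKr.
- by rewrite /ad wx_pp subrr.
- by rewrite /ad central_wxz subrr.
- by rewrite /ad wx_qq subrr oppr0.
- by rewrite /ad opprB wx_pq addrC addKr eq_sym.
- by rewrite /ad central_wxz subrr oppr0.
- by rewrite dz_wx eq_indexE.
- by rewrite dz_wx eq_indexE.
- by rewrite dz_wx eq_indexE eq_sym.
Qed.

Implicit Types (al be : {ffun 'I_s -> nat}).

Definition lower be i k : {ffun 'I_s -> nat} :=
  [ffun j => if j == i then (be j - k)%N else be j].

Lemma dx_mon i be : dx i (mon K be) = (be i)%:R *: mon K (lower be i 1).
Proof.
rewrite /mon (der_prod_unique (i := i)) ?index_enum_uniq ?mem_index_enum //;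
  first last.
- move=> j ne_ji; elim: (be j) => [|k IHk].
    by rewrite expr0 (der1 (dx_der i)).
  by rewrite exprS (derM (dx_der i)) IHk dx_wx eq_sym (negPf ne_ji) mul0r
    mulr0 addr0.
- exact: dx_der.
set c := (be i)%:R; pose F j := if j == i then c else 1.
transitivity (\prod_(j < s) (F j *: wx j ^+ lower be i 1 j)).
  apply: eq_bigr => j _; rewrite /F ffunE; case: eqP => [->|_];
    last by rewrite scale1r.
  by rewrite (derX _ (dx_der i)) ?dx_wx ?eqxx // subn1.
rewrite scaler_prod; congr (_ *: _).
by rewrite (bigD1 i) //= big1 /F ?eqxx ?mulr1 // => j /negPf ->.
Qed.

End StandardPartials.

(** * Ordered monomials *)

Section Monomials.
Variables (K : fieldType) (n m : nat).
Local Notation s := (n + n + m)%N.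
Local Notation W := (weyl_poly K n m).
Local Notation wx := (@wx K n m).
Local Notation mon := (@mon K n m).
Implicit Types (a b : W) (al be : {ffun 'I_s -> nat}).

Lemma iter_dx_mon i k be :
  iter k (dx i) (mon be) = (be i ^_ k)%:R *: mon (lower be i k).
Proof.
elim: k => [|k IHk] /=.
  rewrite ffactn0 scale1r; congr mon.
  by apply/ffunP=> j; rewrite ffunE subn0 if_same.
rewrite IHk (derZ (dx_der K i)) dx_mon scalerA -natrM ffunE eqxx -ffactnSr.
congr (_ *: mon _); apply/ffunP=> j; rewrite !ffunE.
by case: eqP => // _; rewrite -subnDA addn1.
Qed.

(** Each partial derivative touches only the power of its own generator, so
    mixed derivatives of an ordered monomial are computed variable by variable,
    even though the generators do not commute. *)
Lemma foldr_dx_mon (r : seq 'I_s) al be : uniq r ->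
  foldr (fun i => iter (al i) (dx i)) (mon be) r =
    (\prod_(i <- r) be i ^_ al i)%:R *:
      mon [ffun j => if j \in r then (be j - al j)%N else be j].
Proof.
elim: r => [_|i r IHr /= /andP[iNr Ur]] /=.
  rewrite big_nil scale1r; congr mon.
  by apply/ffunP=> j; rewrite ffunE.
rewrite IHr // iter_derZ; last exact: dx_der.
rewrite iter_dx_mon scalerA big_cons ffunE (negPf iNr) mulnC natrM.
congr (_ *: mon _); apply/ffunP=> j; rewrite !ffunE in_cons.
by case: eqP => // ->; rewrite (negPf iNr).
Qed.

Inductive monomial_span : W -> Prop :=
| SpanMon be : monomial_span (mon be)
| SpanLin c a b : monomial_span a -> monomial_span b ->
    monomial_span (c *: a + b).

Lemma span0 : monomial_span 0.
Proof.
rewrite -(addNr (mon [ffun=> 0%N])) -scaleN1r.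
by apply: SpanLin; exact: SpanMon.
Qed.

Lemma spanZ c a : monomial_span a -> monomial_span (c *: a).
Proof. by move=> sa; rewrite -[_ *: _]addr0; apply: SpanLin sa span0. Qed.

Lemma spanD a b : monomial_span a -> monomial_span b -> monomial_span (a + b).
Proof. by move=> sa sb; rewrite -[a]scale1r; exact: SpanLin. Qed.

Lemma commuting_mulX (I : eqType) (r : seq I) (F : I -> W) (g : I -> nat) i :
    (forall j, F i * F j = F j * F i) -> uniq r -> i \in r ->
  F i * \prod_(j <- r) F j ^+ g j = \prod_(j <- r) F j ^+ (g j + (j == i)).
Proof.
move=> cF; elim: r => // j r IHr /= /andP[jNr Ur]; rewrite in_cons !big_cons.
have [eq_ij _|ne_ij /= ir] := eqVneq i j; last first.
  by rewrite mulrA commrX // -mulrA IHr // addn0.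
rewrite -eq_ij addn1 exprS mulrA; congr (_ * _).
apply: eq_big_seq => k kr; case: eqP => [eq_ki|_]; last by rewrite addn0.
by rewrite -eq_ij -eq_ki kr in jNr.
Qed.

Lemma mon_split be : mon be =
  (\prod_(k < n) wx (iq k) ^+ be (iq k)) *
  (\prod_(k < n) wx (ip k) ^+ be (ip k)) *
  (\prod_(j < m) wx (iz j) ^+ be (iz j)).
Proof. by rewrite /Defs.mon big_split_ord big_split_ord. Qed.

Definition raise be i : {ffun 'I_s -> nat} := [ffun j => (be j + (j == i))%N].

Lemma mul_wxq_mon k be : wx (iq k) * mon be = mon (raise be (iq k)).
Proof.
rewrite !mon_split !mulrA; congr (_ * _ * _).
- rewrite (commuting_mulX (F := fun k => wx (iq k))) ?index_enum_uniq
    ?mem_index_enum //.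
    by apply: eq_bigr => l _; rewrite ffunE eq_indexE.
  by move=> l; exact: wx_qq.
- by apply: eq_bigr => l _; rewrite ffunE eq_indexE addn0.
- by apply: eq_bigr => l _; rewrite ffunE eq_indexE addn0.
Qed.

Lemma mul_wxz_mon j be : wx (iz j) * mon be = mon (raise be (iz j)).
Proof.
rewrite !mon_split central_wxz -mulrA -central_wxz; congr (_ * _ * _).
- by apply: eq_bigr => l _; rewrite ffunE eq_indexE addn0.
- by apply: eq_bigr => l _; rewrite ffunE eq_indexE addn0.
- rewrite (commuting_mulX (F := fun k => wx (iz k))) ?index_enum_uniq
    ?mem_index_enum //.
    by apply: eq_bigr => l _; rewrite ffunE eq_indexE.
  by move=> l; exact: central_wxz.
Qed.

(** Of the factors that [p_k] crosses to reach its place, only the power of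
    [q_k] does not commute with it; the error is the commutator with [p_k],
    which is the derivative in [q_k]. *)
Lemma mul_wxp_mon k be :
  wx (ip k) * mon be =
    (be (iq k))%:R *: mon (lower be (iq k) 1) + mon (raise be (ip k)).
Proof.
rewrite -dx_mon dx_q /ad -[LHS](subrK (mon be * wx (ip k))); congr (_ + _).
rewrite !mon_split -mulrA.
have cz : central (\prod_(j < m) wx (iz j) ^+ be (iz j)).
  by apply: central_prod => j _; apply: centralX; exact: central_wxz.
rewrite cz mulrA; congr (_ * _); last first.
  by apply: eq_bigr => l _; rewrite ffunE eq_indexE addn0.
rewrite -mulrA; congr (_ * _).
  by apply: eq_bigr => l _; rewrite ffunE eq_indexE addn0.
have <- : wx (ip k) * \prod_(l < n) wx (ip l) ^+ be (ip l) =
  (\prod_(l < n) wx (ip l) ^+ be (ip l)) * wx (ip k).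
  by apply: commr_prod => l _; apply: commrX; exact: wx_pp.
rewrite (commuting_mulX (F := fun k => wx (ip k))) ?index_enum_uniq
  ?mem_index_enum //.
  by apply: eq_bigr => l _; rewrite ffunE eq_indexE.
by move=> l; exact: wx_pp.
Qed.

(** The span of the ordered monomials contains 1 and is stable under left
    multiplication by each generator, hence it is a left ideal. *)
Lemma monomials_span a : monomial_span a.
Proof.
rewrite -[a]mulr1; have : monomial_span (1 : W).
  have -> : 1 = mon [ffun=> 0%N]; last exact: SpanMon.
  by rewrite /Defs.mon big1 // => i _; rewrite ffunE.
elim/weyl_ind: a (1 : W) => [c|i|a b IHa IHb|a b IHa IHb] u su.
- by rewrite mulr_algl; apply: spanZ.
- elim: su => [be|c a b _ IHa _ IHb]; last first.
    by rewrite mulrDr -scalerAr; apply: SpanLin.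
  case: (indexP i) => k.
  + by rewrite mul_wxq_mon; exact: SpanMon.
  + by rewrite mul_wxp_mon; apply: SpanLin; exact: SpanMon.
  + by rewrite mul_wxz_mon; exact: SpanMon.
- by rewrite mulrDl; apply: spanD; [exact: IHa|exact: IHb].
- by rewrite -mulrA; apply/IHa/IHb.
Qed.

Lemma mon_ind (P : W -> Prop) : (forall be, P (mon be)) ->
  (forall c a b, P a -> P b -> P (c *: a + b)) -> forall a, P a.
Proof. by move=> Pm PL a; elim: (monomials_span a) => // *; exact: PL. Qed.

Lemma dx_nilpotent i : locally_nilpotent (@dx K n m i).
Proof.
elim/mon_ind=> [be|c a b [M nM] [N nN]].
  exists (be i).+1 => k ltk; rewrite iter_dx_mon ffact_small ?scale0r //.
exists (maxn M N) => k; rewrite geq_max => /andP[leM leN].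
rewrite (iter_derD _ _ _ (dx_der K i)) (iter_derZ _ _ _ (dx_der K i)).
by rewrite nM // nN // scaler0 addr0.
Qed.

End Monomials.

(** * Dixmier maps and the Taylor expansion *)

Lemma fsumT_seq (V : nmodType) (I : choiceType) (r : seq I) (F : I -> V) :
  uniq r -> (forall i, i \notin r -> F i = 0) ->
  \sum_(i \in [set: I]%classic) F i = \sum_(i <- r) F i.
Proof.
move=> Ur F0; rewrite (fsbigE r) //; last by move=> i _; exact: F0.
by apply: eq_bigl => i; rewrite in_setT.
Qed.

Section Dixmier.
Variables (K : fieldType) (charK : [pchar K] =i pred0) (n m : nat).
Local Notation s := (n + n + m)%N.
Local Notation W := (weyl_poly K n m).
Local Notation wx := (@wx K n m).
Local Notation mon := (@mon K n m).
Implicit Types (a b x : W) (D : W -> W) (al be g : {ffun 'I_s -> nat}).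

Lemma pchar0_nat_neq0 k : (0 < k)%N -> k%:R != 0 :> K.
Proof. by move=> k_gt0; rewrite (pcharf0P K).1 // -lt0n. Qed.

(** The Taylor series of [a] at [x] with increment [- x]: when [D] is the
    derivative in [x], it substitutes 0 for [x] in elements written with the
    powers of [x] on the left. *)
Definition dixmier x D a : W :=
  \sum_(k \in [set: nat]%classic) ((-1) ^+ k / k`!%:R) *: (x ^+ k * iter k D a).

(** For a finite sum any bound on the order of nilpotence will do, which lets
    two elements be treated with a common bound. *)
Lemma dixmierE N x D a : (forall k, (N <= k)%N -> iter k D a = 0) ->
  dixmier x D a = \sum_(k < N) ((-1) ^+ k / k`!%:R) *: (x ^+ k * iter k D a).
Proof.
move=> nD; rewrite -(big_mkord xpredT
  (fun k => ((-1) ^+ k / k`!%:R) *: (x ^+ k * iter k D a))).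
apply: fsumT_seq => [|k]; first exact: iota_uniq.
by rewrite mem_index_iota /= -leqNgt => /nD ->; rewrite mulr0 scaler0.
Qed.

Lemma dixmier_linear x D c a b : is_derivation D -> locally_nilpotent D ->
  dixmier x D (c *: a + b) = c *: dixmier x D a + dixmier x D b.
Proof.
move=> dD nD; have [[M nM] [N nN]] := (nD a, nD b).
have nMa k : (maxn M N <= k)%N -> iter k D a = 0.
  by rewrite geq_max => /andP[/nM].
have nNb k : (maxn M N <= k)%N -> iter k D b = 0.
  by rewrite geq_max => /andP[_ /nN].
rewrite !(@dixmierE (maxn M N)) //; last first.
  move=> k lek; rewrite iter_derD // iter_derZ // nMa // nNb //.
  by rewrite scaler0 addr0.
rewrite scaler_sumr -big_split; apply: eq_bigr => k _ /=.
rewrite iter_derD // iter_derZ // mulrDr scalerDr -scalerAr.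
by rewrite !scalerA [c * _]mulrC.
Qed.

Lemma dixmier_const x D a : is_derivation D -> D a = 0 -> dixmier x D a = a.
Proof.
move=> dD Da; rewrite (@dixmierE 1).
  by rewrite big_ord1 !expr0 /= !mul1r invr1 scale1r.
by move=> [|k] // _; rewrite iter_der0.
Qed.

Lemma iter_derMx x D k b : is_derivation D -> D x = 1 ->
  iter k D (x * b) = x * iter k D b + k%:R *: iter k.-1 D b.
Proof.
move=> dD Dx; elim: k => [|k IHk] /=; first by rewrite scale0r addr0.
rewrite IHk (derD dD) (derM dD) Dx mul1r (derZ dD) addrAC addrC; congr (_ + _).
case: k {IHk} => [|k] /=; first by rewrite scale0r addr0 scale1r.
by rewrite -{1}[D _]scale1r -scalerDl -mulrS.
Qed.

(** By [iter_derMx] the series of [x * b] is the sum of two series, one from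
    [x * D^k b] and one from [k D^(k-1) b]; after a shift of the index they are
    opposite to each other, since [k / k! = 1 / (k-1)!] in characteristic zero. *)
Lemma dixmier_mulx x D b : is_derivation D -> locally_nilpotent D -> D x = 1 ->
  dixmier x D (x * b) = 0.
Proof.
move=> dD nD Dx; have [N nN] := nD b.
rewrite (@dixmierE N.+1); last first.
  case=> // k leNk; rewrite iter_derMx // !nN ?mulr0 ?scaler0 ?addr0 //.
  exact: leqW.
under eq_bigr => k _ do
  rewrite iter_derMx // mulrDr scalerDr mulrA -exprSr -scalerAr scalerA.
rewrite big_split big_ord_recr /= nN // mulr0 scaler0 addr0.
rewrite big_ord_recl /= mulr0 scale0r add0r -big_split big1 // => k _ /=.
rewrite /bump leq0n add1n -scalerDl exprS mulN1r factS natrM invfM.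
by rewrite -mulrA mulrAC mulVf ?pchar0_nat_neq0 // mul1r mulNr subrr scale0r.
Qed.

Definition dix_fold (r : seq 'I_s) a : W :=
  foldl (fun b i => dixmier (wx i) (dx i) b) a r.

Lemma dix_fold_linear r c a b :
  dix_fold r (c *: a + b) = c *: dix_fold r a + dix_fold r b.
Proof.
elim: r a b => //= i r IHr a b; rewrite -IHr; congr dix_fold.
by apply: dixmier_linear; [exact: dx_der|exact: dx_nilpotent].
Qed.

Lemma dix_fold_const r a :
  (forall i, i \in r -> dx i a = 0) -> dix_fold r a = a.
Proof.
elim: r => //= i r IHr da; rewrite dixmier_const ?da ?mem_head //.
  by apply: IHr => j jr; rewrite da // in_cons jr orbT.
exact: dx_der.
Qed.

Lemma dix_fold0 r : dix_fold r 0 = 0.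
Proof. by rewrite dix_fold_const // => i _; rewrite (der0 (dx_der K i)). Qed.

Lemma dx_wxX i j k : i != j -> dx i (wx j ^+ k) = 0.
Proof.
move=> ne_ij; elim: k => [|k IHk]; first by rewrite (der1 (dx_der K i)).
by rewrite exprS (derM (dx_der K i)) IHk dx_wx (negPf ne_ij) mul0r mulr0 addr0.
Qed.

(** The variables are set to 0 from left to right: when the turn of [x_i] comes,
    all the earlier powers are gone, so that [x_i ^+ g i] stands in front and
    the remaining factors are constants for the derivative in [x_i]. *)
Lemma dix_fold_prod r (g : 'I_s -> nat) v : uniq r ->
    (forall i, i \in r -> dx i v = 0) ->
  dix_fold r ((\prod_(i <- r) wx i ^+ g i) * v) =
    if all (fun i => g i == 0%N) r then v else 0.
Proof.
elim: r => [_ _|i r IHr /= /andP[iNr Ur] dv]; first by rewrite big_nil mul1r.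
have dvr j : j \in r -> dx j v = 0 by move=> jr; rewrite dv // in_cons jr orbT.
rewrite big_cons -mulrA; case: (g i) => [|k] /=; last first.
  rewrite exprS -mulrA dixmier_mulx ?dix_fold0 ?dx_wx ?eqxx //.
    exact: dx_der.
  exact: dx_nilpotent.
rewrite mul1r dixmier_const ?IHr //; first exact: dx_der.
rewrite (derM (dx_der K i)) dv ?mem_head // mulr0 addr0.
rewrite (_ : dx i _ = 0) ?mul0r //.
elim: r iNr {IHr Ur dv dvr} => [|j r IHr].
  by rewrite big_nil (der1 (dx_der K i)).
rewrite in_cons negb_or => /andP[ne_ij iNr].
by rewrite big_cons (derM (dx_der K i)) IHr // dx_wxX // mul0r mulr0 addr0.
Qed.

Lemma dix_fold_mon g : dix_fold (enum 'I_s) (mon g) = (g == [ffun=> 0%N])%:R.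
Proof.
have -> : mon g = (\prod_(i <- enum 'I_s) wx i ^+ g i) * 1.
  by rewrite mulr1 /Defs.mon [index_enum _]unlock enumT.
rewrite dix_fold_prod ?enum_uniq //; last first.
  by move=> i _; rewrite (der1 (dx_der K i)).
rewrite (_ : all _ _ = (g == [ffun=> 0%N])); first by case: (g == _).
apply/allP/eqP=> [g0|-> i _]; last by rewrite ffunE.
by apply/ffunP=> i; rewrite ffunE; apply/eqP/g0/mem_enum.
Qed.

(** All variables being set to 0, only a constant remains. *)
Lemma dix_fold_scalar a : exists c, dix_fold (enum 'I_s) a = c%:A.
Proof.
elim/mon_ind: a => [g|c a b [d da] [e eb]].
  by exists (g == [ffun=> 0%N])%:R; rewrite dix_fold_mon scaler_nat.
by exists (c * d + e); rewrite dix_fold_linear da eb scalerA -scalerDl.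
Qed.

Definition dx_pow al a : W := foldr (fun i => iter (al i) (dx i)) a (enum 'I_s).

Lemma dx_pow_linear al c a b :
  dx_pow al (c *: a + b) = c *: dx_pow al a + dx_pow al b.
Proof.
rewrite /dx_pow; elim: (enum _) => //= i r ->.
by rewrite (iter_derD _ _ _ (dx_der K i)) (iter_derZ _ _ _ (dx_der K i)).
Qed.

Definition taylor_coef a al : W :=
  dix_fold (enum 'I_s) ((mfact al)%:R^-1 *: dx_pow al a).

Lemma taylor_coef_linear c a b al :
  taylor_coef (c *: a + b) al = c *: taylor_coef a al + taylor_coef b al.
Proof.
rewrite /taylor_coef dx_pow_linear scalerDr scalerA mulrC -scalerA.
exact: dix_fold_linear.
Qed.

Lemma mfact_neq0 al : (mfact al)%:R != 0 :> K.
Proof. by apply: pchar0_nat_neq0; apply: prodn_gt0 => i; exact: fact_gt0. Qed.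

(** If [al] is not bounded by [be] the derivative vanishes; if it is, a positive
    multiple of the monomial of exponent [be - al] is left, whose constant term
    is 0 unless [al = be]. *)
Lemma taylor_coef_mon be al : taylor_coef (mon be) al = (al == be)%:R.
Proof.
rewrite /taylor_coef /dx_pow foldr_dx_mon ?enum_uniq //.
rewrite scalerA -[_ *: _]addr0 dix_fold_linear dix_fold0 addr0 dix_fold_mon.
case: (eqVneq al be) => [->|ne_al].
  rewrite (_ : _ == _) ?scaler_nat; last first.
    by apply/eqP/ffunP=> i; rewrite !ffunE mem_enum subnn.
  rewrite (_ : \prod_(i <- _) _ = mfact be)%N ?mulVf ?mfact_neq0 //.
    by rewrite scale1r.
  by rewrite /mfact big_enum; apply: eq_bigr => i _; rewrite ffactnn.
case: eqP => [/ffunP lt0|_]; last by rewrite scaler0.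
have le_be_al i : (be i <= al i)%N.
  by have := lt0 i; rewrite !ffunE mem_enum => /eqP.
have [i lti] : exists i, (be i < al i)%N.
  apply/existsP; apply: contraR ne_al => /existsPn le_al.
  apply/eqP/ffunP=> i; apply/eqP; rewrite eqn_leq le_be_al andbT.
  by rewrite leqNgt le_al.
by rewrite big_enum /= (bigD1 i) //= ffact_small // mul0n mulr0 scale0r.
Qed.

(** Both sides are linear in [a], and for a monomial the expansion has a single
    term. The sum is stated over every list that contains the support, so that
    the expansions of two elements can be added over a common list. *)
Lemma taylor a : exists2 S : seq {ffun 'I_s -> nat},
  (forall al, al \notin S -> taylor_coef a al = 0) &
  forall S', uniq S' -> {subset S <= S'} ->
    a = \sum_(al <- S') taylor_coef a al * mon al.
Proof.
elim/mon_ind: a => [be|c a b [S S0 sumS] [T T0 sumT]].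
  exists [:: be] => [al|S' US' sS'].
    by rewrite inE taylor_coef_mon => /negPf ->.
  rewrite (bigD1_seq be) ?sS' ?mem_head //= big1 ?addr0 => [|al /negPf ne_al].
    by rewrite taylor_coef_mon eqxx mul1r.
  by rewrite taylor_coef_mon ne_al mul0r.
exists (S ++ T) => [al|S' US' sS'].
  rewrite mem_cat negb_or taylor_coef_linear => /andP[alS alT].
  by rewrite S0 // T0 // scaler0 addr0.
rewrite {1}(sumS S') //; last by move=> al alS; rewrite sS' // mem_cat alS.
rewrite {1}(sumT S') //; last by move=> al alT; rewrite sS' // mem_cat alT orbT.
rewrite scaler_sumr -big_split; apply: eq_bigr => al _ /=.
by rewrite taylor_coef_linear mulrDl scalerAl.
Qed.

End Dixmier.

(** * The centre *)

Section Centre.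
Variables (K : fieldType) (charK : [pchar K] =i pred0) (n m : nat).
Local Notation s := (n + n + m)%N.
Local Notation W := (weyl_poly K n m).
Local Notation wx := (@wx K n m).
Local Notation mon := (@mon K n m).
Local Notation P := (mpoly m K).
Local Notation var j := (mpolyX K (mnm1 j)).
Implicit Types (a b : W) (D : W -> W) (p q : P).

(** The inclusion of the algebra of polynomials in the central variables. Having
    commutative polynomials as its source makes determinants and units of
    polynomial rings available for computations in the centre. *)
Definition zpoly : P -> W := mmap (GRing.in_alg W) (fun j => wx (iz j)).

HB.instance Definition _ := GRing.Additive.copy zpoly
  (mmap (GRing.in_alg W) (fun j => wx (iz j))).

Lemma zpoly_monoid_morphism : monoid_morphism zpoly.
Proof.
have [|p mu nu|zM z1] := @commr_mmap_is_multiplicative m K W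
  (fun j => wx (iz j)) (GRing.in_alg W).
- by move=> j x; apply: commr_sym; exact: central_wxz.
- exact: central_alg.
- by split.
Qed.

HB.instance Definition _ := GRing.isMonoidMorphism.Build P W zpoly
  zpoly_monoid_morphism.

Lemma zpolyC c : zpoly (mpolyC m c) = c%:A.
Proof. by rewrite /zpoly mmapC. Qed.

Lemma zpolyX (mu : multinom m) :
  zpoly (mpolyX K mu) = \prod_(j < m) wx (iz j) ^+ mu j.
Proof. by rewrite /zpoly mmapX. Qed.

Lemma zpolyU j : zpoly (var j) = wx (iz j).
Proof. by rewrite /zpoly mmapX mmap1U. Qed.

Lemma zpolyZ c p : zpoly (c *: p) = c *: zpoly p.
Proof. by rewrite /zpoly mmapZ mulr_algl. Qed.

Lemma mpoly_alg_ind (Q : P -> Prop) :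
    (forall c, Q (mpolyC m c)) -> (forall j, Q (var j)) ->
    (forall p q, Q p -> Q q -> Q (p + q)) ->
    (forall p q, Q p -> Q q -> Q (p * q)) ->
  forall p, Q p.
Proof.
move=> QC QX QD QM; have Q1 : Q 1 by rewrite -mpolyC1.
elim/mpolyind=> [|c mu p _ _ Qp]; first by rewrite -mpolyC0.
apply: (QD) Qp; rewrite -mul_mpolyC; apply: (QM) (QC c) _.
rewrite mpolyXE_id; apply: big_ind => // j _.
by elim: (mu j) => // k Qk; rewrite exprS; exact: QM.
Qed.

Lemma central_zpoly p : central (zpoly p).
Proof.
elim/mpoly_alg_ind: p => [c|j|p q cp cq|p q cp cq].
- by rewrite zpolyC; exact: central_alg.
- by rewrite zpolyU; exact: central_wxz.
- by rewrite rmorphD; exact: centralD.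
- by rewrite rmorphM; exact: centralM.
Qed.

Lemma central_morph (f : {lrmorphism W -> W}) (g : W -> W) a : cancel g f ->
  central a -> central (f a).
Proof. by move=> gK ca b; rewrite -[b]gK -!rmorphM ca. Qed.

(** The chain rule. The morphism [f] has to be onto for the images of
    polynomials in the central variables to be central, so that factors can be
    reordered in the Leibniz rule. *)
Lemma der_chain (f : {lrmorphism W -> W}) (g : W -> W) D p :
    cancel g f -> is_derivation D ->
  D (f (zpoly p)) = \sum_(j < m) f (zpoly (mderiv j p)) * D (f (wx (iz j))).
Proof.
move=> gK dD; elim/mpoly_alg_ind: p => [c|j|p q IHp IHq|p q IHp IHq].
- rewrite zpolyC rmorph_alg (derC dD) big1 // => j _.
  by rewrite mderivC !rmorph0 mul0r.
- rewrite zpolyU (bigD1 j) //= big1 ?addr0 => [|k /negPf ne_kj].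
    rewrite mderivX mnm1E eqxx scale1r (_ : mnm_sub _ _ = mnm0) ?mpolyX0
      ?rmorph1 ?mul1r //.
    by apply/mnmP=> i; rewrite mnmBE subnn mnm0E.
  by rewrite mderivX mnm1E eq_sym ne_kj scale0r !rmorph0 mul0r.
- rewrite !rmorphD (derD dD) IHp IHq -big_split; apply: eq_bigr => j _.
  by rewrite mderivD !rmorphD mulrDl.
- rewrite !rmorphM (derM dD) IHp IHq mulr_sumr mulr_suml -big_split.
  apply: eq_bigr => j _ /=.
  rewrite mderivM !rmorphD !rmorphM mulrDl /= !mulrA; congr (_ + _).
  have cq : central (f (zpoly q)) by exact: central_morph gK (central_zpoly q).
  by rewrite -!mulrA cq.
Qed.

Lemma der_zpoly D l p :
    is_derivation D -> (forall j, D (wx (iz j)) = (l == j)%:R) ->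
  D (zpoly p) = zpoly (mderiv l p).
Proof.
move=> dD Dz; rewrite (@der_chain idfun idfun) // (bigD1 l) //= big1 ?addr0.
  by rewrite Dz eqxx mulr1.
by move=> j /negPf ne; rewrite Dz eq_sym ne mulr0.
Qed.

Lemma dz_zpoly l p : dz l (zpoly p) = zpoly (mderiv l p).
Proof.
apply: der_zpoly => [|j]; first exact: dz_der.
by rewrite dz_wx eq_index_zz eq_sym.
Qed.

Lemma dix_fold_zpoly p : dix_fold (enum 'I_s) (zpoly p) = (mcoeff mnm0 p)%:A.
Proof.
elim/mpolyind: p => [|c mu p _ _ IHp].
  by rewrite rmorph0 dix_fold0 mcoeff0 scale0r.
rewrite rmorphD /= zpolyZ dix_fold_linear // IHp mcoeffD mcoeffZ.
rewrite scalerDl -scalerA; congr (_ *: _ + _); rewrite mcoeffX.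
pose g : {ffun 'I_s -> nat} :=
  [ffun i => if fintype.split i is inr j then mu j else 0%N].
have -> : zpoly (mpolyX K mu) = mon g.
  rewrite mon_split zpolyX [X in X * _ * _]big1 ?[X in _ * X * _]big1 ?mul1r.
  - by apply: eq_bigr => j _; rewrite ffunE split_indexE.
  - by move=> k _; rewrite ffunE !split_indexE.
  - by move=> k _; rewrite ffunE !split_indexE.
rewrite dix_fold_mon // scaler_nat; congr (_%:R).
congr nat_of_bool; apply/eqP/eqP=> [/ffunP g0|mu0].
  by apply/mnmP=> j; have := g0 (iz j); rewrite !ffunE split_indexE mnm0E.
by apply/ffunP=> i; rewrite !ffunE; case: fintype.split => // j;
  rewrite mu0 mnm0E.
Qed.

(** The constant coefficient of a polynomial [p] with [zpoly p = 0] vanishes by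
    [dix_fold_zpoly]. The derivatives of [p] are also sent to 0, and in
    characteristic zero their constant coefficients give all the others. *)
Lemma zpoly_inj : injective zpoly.
Proof.
apply: raddf_inj => p p0; apply/mpolyP=> mu; rewrite mcoeff0.
elim: {mu}(mdeg mu) {-2}mu (erefl (mdeg mu)) p p0 => [|k IHk] mu deg_mu p p0.
  move/eqP: deg_mu; rewrite mdeg_eq0 => /eqP ->.
  have := dix_fold_zpoly p; rewrite p0 dix_fold0 // => /esym/eqP.
  by rewrite scaler_eq0 oner_eq0 orbF => /eqP.
(* A monomial of positive degree is a smaller one times some variable [i]: pass
   to the derivative in that variable. *)
have [i nz_i] : exists i, mu i != 0%N.
  apply/existsP; apply: contra_eqT deg_mu => /existsPn mu0.
  rewrite (_ : mu = mnm0) ?mdeg0 //; apply/mnmP=> i.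
  by rewrite mnm0E; apply/eqP; rewrite -[_ == _]negbK.
have def_mu : mu = mnm_add (mnm_sub mu (mnm1 i)) (mnm1 i).
  by rewrite submK // lep1mP.
have degB : mdeg (mnm_sub mu (mnm1 i)) = k.
  by move: deg_mu; rewrite {1}def_mu mdegD mdeg1 addn1 => -[].
have zp0 : zpoly (mderiv i p) = 0.
  by rewrite -dz_zpoly p0 (der0 (dz_der K n i)).
have := mcoeff_mderiv i p (mnm_sub mu (mnm1 i)).
rewrite -def_mu (IHk _ degB _ zp0).
move/esym/eqP; rewrite -mulr_natr mulf_eq0 (negPf (pchar0_nat_neq0 charK _)) //.
by rewrite orbF => /eqP.
Qed.

(** Set to 0 the Weyl generators only. A central element commutes with them, so
    it is a constant for the corresponding derivatives and is left unchanged;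
    on the other hand the result always lies in the span of the monomials in
    the central variables. *)
Lemma central_is_zpoly a : central a -> exists p, a = zpoly p.
Proof.
move=> ca; pose r := [seq lshift m k | k <- enum 'I_(n + n)].
have dx0 b i : central b -> i \in r -> dx i b = 0.
  move=> cb /mapP[k _ ->].
  rewrite -[k]splitK; case: (fintype.split k) => l /=.
    by rewrite -/(iq l) dx_q /ad cb subrr.
  by rewrite -/(ip l) dx_p /ad cb subrr oppr0.
suff [p def_p] : exists p, dix_fold r a = zpoly p.
  by exists p; rewrite -def_p dix_fold_const // => i; exact: dx0.
elim/mon_ind: a {ca} => [be|c a b [p pa] [q qb]]; last first.
  by exists (c *: p + q); rewrite dix_fold_linear // pa qb rmorphD /= zpolyZ.
pose mu : multinom m := Multinom [tuple be (iz j) | j < m].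
have -> : mon be = (\prod_(i <- r) wx i ^+ be i) * zpoly (mpolyX K mu).
  rewrite /Defs.mon big_split_ord /r big_map zpolyX.
  rewrite [index_enum (ordinal (n + n))]unlock enumT.
  by congr (_ * _); apply: eq_bigr => j _; rewrite mnmE.
rewrite dix_fold_prod //; last by move=> i; apply: dx0; exact: central_zpoly.
  by case: all; [exists (mpolyX K mu)|exists 0; rewrite rmorph0].
by rewrite map_inj_uniq ?enum_uniq //; exact: lshift_inj.
Qed.

End Centre.

(** * Transport along an automorphism *)

Section Jacobian.
Variables (K : fieldType) (charK : [pchar K] =i pred0) (n m : nat).
Local Notation s := (n + n + m)%N.
Local Notation W := (weyl_poly K n m).
Local Notation wx := (@wx K n m).
Local Notation mon := (@mon K n m).
Local Notation zpoly := (@zpoly K n m).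
Local Notation P := (mpoly m K).
Variables (sigma tau : {lrmorphism W -> W}).
Hypotheses (sigmaK : cancel sigma tau) (tauK : cancel tau sigma).

Lemma morph_zpoly (f g : {lrmorphism W -> W}) p : cancel g f ->
  exists q, f (zpoly p) = zpoly q.
Proof.
move=> gK; apply: (central_is_zpoly charK).
exact: (central_morph gK (central_zpoly p)).
Qed.

(** The required [d_l] has to coincide on the centre with [d/dx_(2n+l)] and to
    kill the images of the Weyl generators. Conjugation by [sigma] turns the
    second condition into the vanishing on the Weyl generators themselves, which
    holds for combinations of the [dz j] with central coefficients; the
    coefficients [c l j] are those for which the first condition holds at each
    [sigma (x_(2n+j))], and these generate the centre. *)
Lemma partials_exist : exists d, is_partials sigma d.
Proof.
(* [c l j] pulls back by [sigma] the value at [sigma (x_(2n+j))] of the usual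
   derivative in the [l]-th central variable. *)
pose c l j := tau (dz l (sigma (wx (iz j)))).
have cc l j : central (c l j).
  rewrite /c; apply: (central_morph sigmaK); apply: der_central.
    exact: dz_der.
  exact: (central_morph tauK (central_wxz j)).
pose D l a : W := \sum_(j < m) c l j * dz j a.
have dD l : is_derivation (D l).
  by apply: der_sum => j _; apply: der_centralZ; [exact: dz_der|].
exists (fun l a => sigma (D l (tau a))) => l.
have dd : is_derivation (fun a => sigma (D l (tau a))) by exact: der_conj.
split=> [//|i|k].
  rewrite sigmaK /D big1 ?rmorph0 // => j _.
  by rewrite dz_wx eq_index_lz mulr0.
have [G defG] := morph_zpoly (mpolyX K (mnm1 k)) sigmaK.
rewrite -[wx (iz k)]tauK -zpolyU defG.
rewrite (der_chain G tauK dd).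
(* [x_(2n+k)] is [sigma] of a polynomial in the central variables, so the chain
   rule compares the new derivation with [dz l] through the values at the
   [sigma (x_(2n+j))]. *)
transitivity (dz l (sigma (zpoly G))).
  rewrite (der_chain G tauK (dz_der K n l)).
  apply: eq_bigr => j _; congr (_ * _).
  rewrite sigmaK /D (bigD1 j) //= big1 ?addr0.
    by rewrite dz_wx eqxx mulr1 /c tauK.
  by move=> i /negPf ne_ij; rewrite dz_wx eq_index_zz eq_sym ne_ij mulr0.
by rewrite -defG tauK zpolyU dz_wx eq_index_zz eq_sym.
Qed.

Variable d : 'I_m -> W -> W.
Hypothesis dP : is_partials sigma d.

Let d_der l : is_derivation (d l). Proof. by have [] := dP l. Qed.

Let d_zpoly l p : d l (zpoly p) = zpoly (mderiv l p).
Proof. by apply: der_zpoly; [exact: d_der|have [] := dP l]. Qed.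

(** The chain rule applied to [sigma (tau (x_(2n+k))) = x_(2n+k)] exhibits a
    left inverse, with central entries, of the jacobian matrix. *)
Lemma jacobian_unit : exists F : 'I_m -> P,
  (forall k, sigma (wx (iz k)) = zpoly (F k)) /\
  \det (\matrix_(k < m, l < m) mderiv l (F k)) \is a GRing.unit.
Proof.
have /choice[F defF] k : exists p, sigma (wx (iz k)) = zpoly p.
  by rewrite -zpolyU; exact: morph_zpoly tauK.
exists F; split=> //.
have /choice[G defG] k : exists p, tau (wx (iz k)) = zpoly p.
  by rewrite -zpolyU; exact: morph_zpoly sigmaK.
have /choice[H defH] (kj : 'I_m * 'I_m) :
    exists p, sigma (zpoly (mderiv kj.2 (G kj.1))) = zpoly p.
  exact: morph_zpoly tauK.
set J := \matrix_(k, l) _.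
pose M := \matrix_(k < m, j < m) H (k, j).
have MJ : M *m J = 1%:M.
  apply/matrixP=> k l; apply: (@zpoly_inj _ charK n m).
  rewrite !mxE rmorph_sum /=.
  transitivity (d l (sigma (zpoly (G k)))).
    rewrite (der_chain _ tauK (d_der l)); apply: eq_bigr => j _.
    by rewrite !mxE rmorphM /= -defH defF d_zpoly.
  by rewrite -defG tauK; have [_ _ ->] := dP l; rewrite rmorph_nat eq_sym.
have /mpoly_intro_unit // : \det M * \det J = 1.
by rewrite -det_mulmx MJ det1.
Qed.

(** The units of a polynomial ring over a field are the nonzero constants. *)
Lemma Delta_spec :
  (Delta sigma d)%:A = \det (jacobian sigma d) /\ Delta sigma d != 0.
Proof.
have [F [defF]] := jacobian_unit.
set J := \matrix_(k, l) _ => uJ.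
have detJ : \det (jacobian sigma d) = zpoly (\det J).
  rewrite -det_map_mx; congr (\det _); apply/matrixP=> k l.
  by rewrite !mxE defF d_zpoly.
have [/eqP constJ _] := andP uJ.
have specD : (Delta sigma d)%:A = \det (jacobian sigma d).
  rewrite /Delta; case: xgetP => [c -> //|].
  by move=> /(_ (mcoeff mnm0 (\det J))) /=; rewrite detJ {2}constJ zpolyC; case.
split=> //; apply: contraTneq uJ => D0.
have -> : \det J = 0.
  by apply: (@zpoly_inj _ charK n m); rewrite -detJ -specD D0 scale0r rmorph0.
by rewrite unitr0.
Qed.

Lemma prod_central_factor (r : seq 'I_m) (j : 'I_m) (c : 'I_m -> W) (x : W) :
    (forall k, k != j -> central (c k)) -> uniq r ->
  \prod_(k <- r) (if k == j then x else c k) =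
    (\prod_(k <- r) (if k == j then 1 else c k)) * (if j \in r then x else 1).
Proof.
move=> cc; elim: r => [|k r IHr] /=; first by rewrite !big_nil mulr1.
case/andP=> kNr Ur; rewrite !big_cons IHr // in_cons eq_sym.
case: (eqVneq k j) => [eq_kj|ne_kj]; last by rewrite mulrA.
rewrite -eq_kj (negPf kNr) mulr1 mul1r; apply/esym/central_prod => i _.
by case: (eqVneq i k) => [_|ne_ik]; [exact: central1|apply: cc; rewrite -eq_kj].
Qed.

(** Each term of the Leibniz expansion is a central element times one of the
    derivations [d l]. *)
Lemma det_row_der (j : 'I_m) (A : 'I_m -> 'I_m -> W) :
    (forall k l, central (A k l)) ->
  is_derivation (fun a =>
    \det (\matrix_(k < m, l < m) if k == j then d l a else A k l)).
Proof.
move=> cA; apply: der_sum => s _.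
have sgn_c (b : bool) : central ((-1) ^+ b : W).
  by case: b; [rewrite expr1 -scaleN1r; exact: central_alg|exact: central1].
apply: der_centralZ (sgn_c _).
under eq_fun => a.
  under eq_bigr => k _.
    rewrite mxE (_ : (if _ then _ else _) =
      if k == j then d (s j) a else A k (s k)); last by case: eqP => // ->.
    over.
  rewrite prod_central_factor ?index_enum_uniq ?mem_index_enum //.
  over.
apply: der_centralZ; first exact: d_der.
by apply: central_prod => k _; case: ifP => _; [exact: central1|].
Qed.

Lemma dprime_der i : is_derivation (dprime sigma d i).
Proof.
case: (indexP i) => k; rewrite /dprime !split_indexE.
- exact: der_ad.
- by apply: der_opp; exact: der_ad.
apply: der_scale; apply: (@det_row_der k (fun j l => d l (sigma (wx (iz j)))))
  => j l.
by apply: der_central => //; exact: (central_morph tauK (central_wxz _)).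
Qed.

(** With the row of the derivatives of [sigma x_i] in place of row [j], the
    determinant is that of the jacobian if [x_i] is the [j]-th central variable,
    has two equal rows if it is another one, and a zero row if it is a Weyl
    generator. *)
Lemma dprime_z_gen j i : dprime sigma d (iz j) (sigma (wx i)) = (iz j == i)%:R.
Proof.
rewrite /dprime split_indexE.
have [specD nzD] := Delta_spec; have [F [defF _]] := jacobian_unit.
have detE (Q : P) : (forall l, d l (sigma (wx i)) = zpoly (mderiv l Q)) ->
  \det (\matrix_(k < m, l < m)
    (if k == j then d l (sigma (wx i)) else d l (sigma (wx (iz k)))))
  = zpoly (\det (\matrix_(k < m, l < m) mderiv l (if k == j then Q else F k))).
  move=> dQ; rewrite -det_map_mx; congr (\det _); apply/matrixP=> k l.
  by rewrite !mxE; case: eqP => // _; rewrite defF d_zpoly.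
case: (fintype.split i) (splitK i) => i' /= def_i.
  (* A Weyl generator: the row is that of the partial derivatives of 0. *)
  rewrite (detE 0) => [|l]; last first.
    by rewrite -def_i; have [_ -> _] := dP l; rewrite mderiv0 rmorph0.
  rewrite -def_i.
  rewrite (expand_det_row _ j) big1 ?rmorph0 ?scaler0 ?eq_index_zl // => l _.
  by rewrite mxE eqxx mderiv0 mul0r.
rewrite -[rshift _ _]/(iz i') in def_i; rewrite -def_i eq_index_zz in detE *.
have [eq_ji|ne_ji] := eqVneq j i'.
  rewrite (_ : \matrix_(k, l) _ = jacobian sigma d).
    by rewrite -specD scalerA mulVf // scale1r.
  by apply/matrixP=> k l; rewrite !mxE; case: eqP => // ->; rewrite eq_ji.
rewrite (detE (F i')) => [|l]; last by rewrite defF d_zpoly.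
rewrite (determinant_alternate ne_ji) ?rmorph0 ?scaler0 // => l.
by rewrite !mxE eqxx eq_sym (negPf ne_ji).
Qed.

(** For the Weyl generators this is the naturality of commutators. For the
    central variables both sides are derivations, and they agree on the
    [sigma x_i]. *)
Lemma dprimeE i a : dprime sigma d i (sigma a) = sigma (dx i a).
Proof.
case: (indexP i) => k.
- by rewrite dx_q /dprime !split_indexE /ad rmorphB !rmorphM.
- by rewrite dx_p /dprime !split_indexE /ad rmorphN rmorphB !rmorphM.
rewrite -{2}[a]sigmaK.
apply: (@der_ext _ _ _ sigma _ (fun b => sigma (dx (iz k) (tau b)))) => [||i'].
- exact: dprime_der.
- by apply: der_conj => //; exact: dx_der.
- by rewrite dprime_z_gen sigmaK dx_wx rmorph_nat.
Qed.

Lemma iter_dprimeE i k a :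
  iter k (dprime sigma d i) (sigma a) = sigma (iter k (dx i) a).
Proof. by elim: k => //= k ->; rewrite dprimeE. Qed.

Lemma dprime_nilpotent i : locally_nilpotent (dprime sigma d i).
Proof.
move=> a; have [N nN] := dx_nilpotent i (tau a).
by exists N => k leNk; rewrite -[a]tauK iter_dprimeE nN // rmorph0.
Qed.

Lemma phi1E i a : phi1 sigma d i (sigma a) = sigma (dixmier (wx i) (dx i) a).
Proof.
have [N nN] := dx_nilpotent i a.
rewrite (dixmierE _ nN) -[phi1 _ _ _ _]/(dixmier _ _ _) (@dixmierE _ _ _ N)
  => [|k leNk].
  rewrite rmorph_sum; apply: eq_bigr => k _ /=.
  by rewrite linearZ rmorphM rmorphXn /= iter_dprimeE.
by rewrite iter_dprimeE nN // rmorph0.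
Qed.

Lemma phiE a : phi sigma d (sigma a) = sigma (dix_fold (enum 'I_s) a).
Proof.
by rewrite /phi /dix_fold; elim: (enum _) a => //= i r IHr a; rewrite phi1E IHr.
Qed.

Lemma dprime_powE al a : dprime_pow sigma d al (sigma a) = sigma (dx_pow al a).
Proof.
by rewrite /dprime_pow /dx_pow; elim: (enum _) => //= i r ->;
  rewrite iter_dprimeE.
Qed.

(** The Taylor coefficients of [tau a] are scalars, so [sigma] fixes them. *)
Lemma inv_termE a al : inv_term sigma d a al = taylor_coef (tau a) al * mon al.
Proof.
rewrite /inv_term -[in LHS](tauK a) dprime_powE -linearZ phiE.
rewrite -/(taylor_coef _ _).
have [c ->] : exists c, taylor_coef (tau a) al = c%:A by exact: dix_fold_scalar.
by rewrite rmorph_alg.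
Qed.

Lemma inversion_formula a :
  finite_set [set al | inv_term sigma d a al != 0]%classic /\
  tau a = \sum_(al \in [set: {ffun 'I_s -> nat}]%classic) inv_term sigma d a al.
Proof.
have [S S0 sumS] := taylor charK (tau a).
have S0' al : al \notin undup S -> inv_term sigma d a al = 0.
  by rewrite mem_undup inv_termE => /S0 ->; rewrite mul0r.
split.
  apply: (sub_finite_set _ (finite_seq (undup S))) => al /=.
  by apply: contraR => /S0' ->.
rewrite (fsumT_seq (undup_uniq S) S0') {1}(sumS _ (undup_uniq S)) => [|al].
  by apply: eq_bigr => al _; rewrite inv_termE.
by rewrite mem_undup.
Qed.

End Jacobian.

Theorem theorem2p4 (K : fieldType) (charK : [pchar K] =i pred0) (n m : nat)
    (sigma : {lrmorphism weyl_poly K n m -> weyl_poly K n m})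
    (sigma_inv : weyl_poly K n m -> weyl_poly K n m)
    (sigmaK : cancel sigma sigma_inv) (sigma_invK : cancel sigma_inv sigma) :
  (exists d : 'I_m -> weyl_poly K n m -> weyl_poly K n m,
     is_partials sigma d) /\
  forall d : 'I_m -> weyl_poly K n m -> weyl_poly K n m,
    is_partials sigma d ->
    (forall i : 'I_(n + n + m), locally_nilpotent (dprime sigma d i)) /\
    forall a : weyl_poly K n m,
      finite_set [set alpha | inv_term sigma d a alpha != 0]%classic /\
      sigma_inv a =
        \sum_(alpha \in [set: {ffun 'I_(n + n + m) -> nat}]%classic)
          inv_term sigma d a alpha.
Proof.
pose tau : {lrmorphism weyl_poly K n m -> weyl_poly K n m} :=
  HB.pack sigma_inv
    (GRing.isLinear.Build K _ _ _ sigma_inv (can2_linear sigmaK sigma_invK))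
    (GRing.isMonoidMorphism.Build _ _ sigma_inv
       (can2_monoid_morphism sigmaK sigma_invK)).
split=> [|d dP]; first exact: (@partials_exist _ charK _ _ sigma tau).
split=> [i|a]; first exact: (@dprime_nilpotent _ charK _ _ sigma tau).
exact: (@inversion_formula _ charK _ _ sigma tau).
Qed.
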